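(* There are exactly two squared squares (and their mirrored versions) of size at most $17$: one of size $11$, namely the dissection $D_{11}$, and one of size $16$, namely the dissection $D_{16}$. That is, $D_{11}$ and $D_{16}$ are squared squares of sizes $11$ and $16$, and every squared square of integer size $n\le 17$ is $D_{11}$, $D_{16}$, or a mirrored version of one of these.
   Context: A squared square of size $n$ ($n$ a positive integer) is a dissection of the square $[0,n]\times[0,n]$ into a finite number, at least two, of squares with positive integer side lengths (the elements; sides parallel to the axes, interiors pairwise disjoint, union the whole square) which is nontrivial: no two elements of the same size share a full border (i.e. no two elements of equal side length have a full side in common). Apart from this, equal sizes are allowed. A mirrored version of a dissection is its image under a reflection symmetry of the big square. Write $(x,y;s)$ for the element $[x,x+s]\times[y,y+s]$. $D_{11}$ is the dissection of $[0,11]^2$ into the 17 elements: $(0,0;4)$, $(7,0;4)$, $(0,7;4)$, $(7,7;4)$, $(4,0;3)$, $(0,4;3)$, $(8,4;3)$, $(4,8;3)$, $(4,3;2)$, $(6,4;2)$, $(3,5;2)$, $(5,6;2)$, $(3,4;1)$, $(6,3;1)$, $(5,5;1)$, $(7,6;1)$, $(4,7;1)$. $D_{16}$ is the dissection of $[0,16]^2$ into the 21 elements: $(0,0;4)$, $(12,0;4)$, $(0,12;4)$, $(12,12;4)$, $(7,0;5)$, $(0,4;5)$, $(11,7;5)$, $(4,11;5)$, $(5,5;6)$, $(4,0;3)$, $(13,4;3)$, $(0,9;3)$, $(9,13;3)$, $(5,3;2)$, $(11,5;2)$, $(3,9;2)$, $(9,11;2)$, $(4,3;1)$, $(12,4;1)$,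 $(3,11;1)$, $(11,12;1)$. *)

(* Defs.v *)
From HB Require Import structures.
From mathcomp Require Import all_boot all_order all_algebra.
From mathcomp Require Import all_classical all_reals all_analysis.
Import numFieldNormedType.Exports.
Import Order.TTheory GRing.Theory Num.Theory.

Set Implicit Arguments.
Unset Strict Implicit.
Unset Printing Implicit Defensive.

Local Open Scope classical_set_scope.
Local Open Scope ring_scope.

(* [(x, y, s)] stands for (x,y;s).  Only the side length is integral; the
   corner is an arbitrary point of the plane. *)
Definition element (R : realType) : Type := (R * R * nat)%type.

Definition rectangle (R : realType) (a b c d : R) : set (R * R) :=
  `[a, b] `*` `[c, d].

Definition square (R : realType) (e : element R) : set (R * R) :=
  rectangle e.1.1 (e.1.1 + e.2%:R) e.1.2 (e.1.2 + e.2%:R).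

(* The four sides of an element, as degenerate rectangles. *)
Definition sides (R : realType) (e : element R) : set (set (R * R)) :=
  let: (x, y, s) := e in
  [set rectangle x x y (y + s%:R);
       rectangle (x + s%:R) (x + s%:R) y (y + s%:R);
       rectangle x (x + s%:R) y y;
       rectangle x (x + s%:R) (y + s%:R) (y + s%:R)].

Record dissection (R : realType) (n : nat) (D : set (element R)) : Prop := {
  dissection_finite : finite_set D;
  dissection_two : exists e e', [/\ D e, D e' & e <> e'];
  dissection_pos : forall e, D e -> (0 < e.2)%N;
  dissection_disjoint : trivIset D (fun e => (square e)°);
  dissection_cover : \bigcup_(e in D) square e = rectangle 0 n%:R 0 n%:R
}.

Definition nontrivial (R : realType) (D : set (element R)) : Prop :=
  forall e e', D e -> D e' -> e <> e' -> e.2 = e'.2 ->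
    sides e `&` sides e' = set0.

Definition squared_square (R : realType) (n : nat) (D : set (element R)) :
    Prop :=
  [/\ (0 < n)%N, dissection n D & nontrivial D].

(* The reflections of the plane that preserve [0,n] x [0,n]: in the two
   midlines and in the two diagonals. *)
Definition reflections (R : realType) (n : nat) : set (R * R -> R * R) :=
  [set (fun p => (n%:R - p.1, p.2));
       (fun p => (p.1, n%:R - p.2));
       (fun p => (p.2, p.1));
       (fun p => (n%:R - p.2, n%:R - p.1))].

Definition mirrored (R : realType) (n : nat) (D D' : set (element R)) : Prop :=
  exists2 f, reflections n f &
    [set square e | e in D'] = [set f @` square e | e in D].

Definition of_seq (R : realType) (s : seq (nat * nat * nat)) :
    set (element R) :=
  [set (t.1.1%:R, t.1.2%:R, t.2) | t in [set` s]].

Definition D11 (R : realType) : set (element R) := of_seq [::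
  (0, 0, 4); (7, 0, 4); (0, 7, 4); (7, 7, 4);
  (4, 0, 3); (0, 4, 3); (8, 4, 3); (4, 8, 3);
  (4, 3, 2); (6, 4, 2); (3, 5, 2); (5, 6, 2);
  (3, 4, 1); (6, 3, 1); (5, 5, 1); (7, 6, 1); (4, 7, 1)]%N.
Arguments D11 : clear implicits.

Definition D16 (R : realType) : set (element R) := of_seq [::
  (0, 0, 4); (12, 0, 4); (0, 12, 4); (12, 12, 4);
  (7, 0, 5); (0, 4, 5); (11, 7, 5); (4, 11, 5);
  (5, 5, 6);
  (4, 0, 3); (13, 4, 3); (0, 9, 3); (9, 13, 3);
  (5, 3, 2); (11, 5, 2); (3, 9, 2); (9, 11, 2);
  (4, 3, 1); (12, 4, 1); (3, 11, 1); (11, 12, 1)]%N.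
Arguments D16 : clear implicits.

(* Main.v *)
Require Import Defs.
From mathcomp Require Import all_boot all_order all_algebra.
From mathcomp Require Import all_classical all_reals all_analysis.
From mathcomp Require Import zify lra.
Import Order.TTheory GRing.Theory Num.Theory numFieldNormedType.Exports.
Set Implicit Arguments.
Unset Strict Implicit.
Unset Printing Implicit Defensive.

(** Half-open elements cover every point of the half-open big square exactly
    once.  Just to the left of an element whose abscissa is positive lies an
    element ending exactly there, so by descent all corners are integral and
    the dissection is a tiling of the [n * n] grid by integer squares.  Such
    tilings can be enumerated by always filling the lowest, then leftmost, free
    cell: equal squares that share a full side are then detected as soon as the
    second one is placed, and this condition cuts the search down to about
    114000 nodes for [n = 17].  The only tilings that survive are [D11], [D16]
    and their transposes; being invariant under quarter turns, these two
    dissections have no further mirror images. *)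

(** * Exhaustive search for tilings of the grid *)

Definition covers (t : nat * nat * nat) i j :=
  (t.1.1 <= i < t.1.1 + t.2) && (t.1.2 <= j < t.1.2 + t.2).

(** Nontriviality is the last two fields: equal squares sharing a full side are neighbours, and
    looking right and up sees every such pair. [tiling_proper] stands for the presence of two
    elements. *)
Record tiling n (T : seq (nat * nat * nat)) : Prop := {
  tiling_range t : t \in T -> [/\ 0 < t.2, t.1.1 + t.2 <= n & t.1.2 + t.2 <= n];
  tiling_cover i j : i < n -> j < n -> exists2 t, t \in T & covers t i j;
  tiling_disjoint t t' i j :
    t \in T -> t' \in T -> covers t i j -> covers t' i j -> t = t';
  tiling_proper : (0, 0, n) \notin T;
  tiling_right x y s : (x, y, s) \in T -> (x + s, y, s) \notin T;
  tiling_above x y s : (x, y, s) \in T -> (x, y + s, s) \notin T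
}.

(** Cells are visited row by row; the next one is [(i, j)], and [P] lists the
    squares placed so far.  Columns are kept in a zipper: those before [i] are
    in [L], nearest first, and describe row [j.+1]; the others are in [R] and
    describe row [j].  An entry [(r, f)] says that [r] cells of the column,
    counted upwards from that row, are already covered, and that no square of
    size [f] may be placed with its corner just above them; likewise no square
    of size [lf] may be placed at [(i, j)].  The size [0] forbids nothing.  The
    conditional is there because [||] is strict under [vm_compute]. *)
Fixpoint search n (good : pred (seq (nat * nat * nat))) fuel i j lf
    (P : seq (nat * nat * nat)) (L R : seq (nat * nat)) : bool :=
  if fuel is k.+1 then
    match R with
    | [::] =>
      if j.+1 == n then good P else search n good k 0 j.+1 0 P [::] (rev L)
    | (r.+1, f) :: R' => search n good k i.+1 j 0 P ((r, f) :: L) R'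
    | (0, f) :: _ =>
      all (fun s =>
             if (s == f) || (s == lf) then true
             else search n good k (i + s) j s ((i, j, s) :: P)
                    (nseq s.-1 (s.-1, 0) ++ (s.-1, s) :: L) (drop s R))
        (iota 1 (minn (find (fun c => 0 < c.1) R) (n - j)))
    end
  else false.

(** Initially [lf = n] rules out the square that fills everything. *)
Definition search_all n good :=
  search n good (n * n.+1).+1 0 0 n [::] [::] (nseq n (0, 0)).

(** * Soundness of the search *)

Section Search.
Variables (n : nat) (T : seq (nat * nat * nat)).
Hypothesis tilT : tiling n T.

Definition before i j (t : nat * nat * nat) :=
  (t.1.2 < j) || (t.1.2 == j) && (t.1.1 < i).

Definition column_ok i j k l (c : nat * nat) :=
  (forall t m, t \in T -> l <= m -> covers t k m ->
     before i j t = (m < l + c.1)) /\ (k, l + c.1, c.2) \notin T.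

(** The state agrees with the fixed tiling [T], visited up to cell [(i, j)]. Columns left of [i] are
    described from row [j.+1], whence the boolean [k < i] added to [j]. *)
Record search_inv i j lf (P : seq (nat * nat * nat)) (L R : seq (nat * nat)) :
    Prop := {
  inv_row : j < n;
  inv_left : size L = i;
  inv_right : i + size R = n;
  inv_column k : k < n ->
    column_ok i j k (j + (k < i)) (nth (0, 0) (catrev L R) k);
  inv_forbidden : (i, j, lf) \notin T;
  inv_placed t : (t \in P) = (t \in T) && before i j t
}.

Lemma tiling_size0 x y : (x, y, 0) \notin T.
Proof. by apply/negP => /(tiling_range tilT)[]. Qed.

Lemma inv_newline i j lf P L : j.+1 < n ->
  search_inv i j lf P L [::] -> search_inv 0 j.+1 0 P [::] (rev L).
Proof.
move=> ltjn [jn szL szR colP _ PP].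
have in_ : i = n by rewrite -szR addn0.
rewrite {}in_ {szR} in szL colP PP.
have bE t : t \in T -> before n j t = before 0 j.+1 t.
  move=> /(tiling_range tilT); case: t => [[x y] s] /= [*].
  rewrite /before /=; lia.
split=> //.
- by rewrite size_rev szL.
- move=> k kn; have := colP k kn; rewrite /= kn addn1 addn0.
  by move=> [c1 c2]; split=> [t m tT lm cv|//]; rewrite -bE //; apply: c1.
- exact: tiling_size0.
- by move=> t; rewrite PP; case: (boolP (t \in T)) => //= tT; rewrite bE.
Qed.

(** The cell [(i, j)] is covered by an earlier square, so no square of [T] has its corner there and
    the set of placed squares does not change. *)
Lemma inv_shift i j lf P L r f R :
  search_inv i j lf P L ((r.+1, f) :: R) ->
  search_inv i.+1 j 0 P ((r, f) :: L) R.
Proof.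
move=> [jn szL szR colP _ PP]; rewrite /= in szR.
have ltin : i < n by lia.
have nthi e R' : nth (0, 0) (catrev L (e :: R')) i = e.
  by rewrite catrevE nth_cat size_rev szL ltnn subnn.
have bE t : t \in T -> before i.+1 j t = before i j t.
  case: t => [[x y] s] tT; have [/= s0 _ _] := tiling_range tilT tT.
  have [c1 _] := colP i ltin; rewrite nthi ltnn addn0 /= in c1.
  have := c1 _ j tT (leqnn j); rewrite /covers /before /=; lia.
split=> //=; [by rewrite szL|lia| | |].
- move=> k kn; have [c1 c2] := colP k kn.
  have -> : nth (0, 0) (catrev L ((r, f) :: R)) k =
      if k == i then (r, f) else nth (0, 0) (catrev L ((r.+1, f) :: R)) k.
    rewrite !catrevE !nth_cat size_rev szL; case: ltngtP => // [|->].
      by rewrite -subn_gt0; case: (k - i).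
    by rewrite subnn.
  have [ki|ki] := eqVneq k i.
    subst k; rewrite nthi ltnn addn0 /= in c1 c2.
    rewrite /column_ok ltnSn /= addn1 addSnnS; split=> // t m tT lm cv.
    by rewrite bE // (c1 t m) // ltnW.
  have -> : (k < i.+1) = (k < i) by lia.
  by split=> // t m tT lm cv; rewrite bE // (c1 t m).
- exact: tiling_size0.
- by move=> t; rewrite PP; case: (boolP (t \in T)) => //= tT; rewrite bE.
Qed.

(** The square of [T] at the next cell survives every pruning test, so the search does try it. *)
Lemma inv_place_size i j lf P L f R s :
  search_inv i j lf P L ((0, f) :: R) -> (i, j, s) \in T ->
  [/\ s != f, s != lf &
      s \in iota 1 (minn (find (fun c => 0 < c.1) ((0, f) :: R)) (n - j))].
Proof.
move=> [jn szL szR colP lfP _] tT.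
have [/= s0 xs ys] := tiling_range tilT tT; rewrite /= in szR.
have nthR k : nth (0, 0) (catrev L ((0, f) :: R)) (i + k)
            = nth (0, 0) ((0, f) :: R) k.
  by rewrite catrevE nth_cat size_rev szL ltnNge leq_addr /= addKn.
(* The cell [(i + k, j)] belongs to [(i, j, s)], which is not placed yet. *)
have c k : k < s -> (nth (0, 0) ((0, f) :: R) k).1 = 0.
  move=> ks; have [|c1 _] := colP (i + k); first by lia.
  rewrite nthR in c1; have := c1 _ j tT; rewrite /covers /before /=; lia.
split.
- apply: contraL tT => /eqP->; have [|_] := colP i; first by lia.
  by rewrite -[X in nth _ _ X]addn0 nthR ltnn !addn0.
- by apply: contraL tT => /eqP->.
- rewrite mem_iota s0 /= add1n ltnS leq_min; apply/andP; split; last by lia.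
  rewrite leqNgt; apply/negP => lts.
  have szs : s <= size ((0, f) :: R) by rewrite /=; lia.
  have hs : has (fun c => 0 < c.1) ((0, f) :: R).
    by rewrite has_find; apply: leq_trans lts szs.
  by have := nth_find (0, 0) hs; rewrite c.
Qed.

Lemma inv_place i j lf P L f R s :
  search_inv i j lf P L ((0, f) :: R) -> (i, j, s) \in T ->
  search_inv (i + s) j s ((i, j, s) :: P)
    (nseq s.-1 (s.-1, 0) ++ (s.-1, s) :: L) (drop s ((0, f) :: R)).
Proof.
move=> inv0 tT; have [_ _ szs] := inv_place_size inv0 tT.
move: inv0 => [jn szL szR colP lfP PP].
have [/= s0 xs ys] := tiling_range tilT tT; rewrite /= in szR.
have bE t : t \in T -> before (i + s) j t = (t == (i, j, s)) || before i j t.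
  move=> tT'; have [/= s0' _ _] := tiling_range tilT tT'.
  have := @tiling_disjoint _ _ tilT t (i, j, s) t.1.1 t.1.2 tT' tT.
  case: eqP => [->|/eqP ne]; first by rewrite /before /=; lia.
  move: t tT' s0' ne => [[x y] z] /= tT' s0' /eqP ne dis.
  rewrite /before /=; apply/idP/idP; last by lia.
  move=> /orP[->//|/andP[/eqP yj xi]]; subst y; rewrite ltnn eqxx /=.
  (* A corner in this stretch of row [j] lies in the new square, so disjointness makes the two
     squares equal. *)
  rewrite ltnNge; apply/negP => ix; apply: ne; apply: dis;
    rewrite /covers /=; lia.
(* From row [j.+1] on, the new square still covers [s.-1] cells of its columns. Only the leftmost
   one, where an equal square on top would have its corner, forbids [s]. *)
have nthk k : nth (0, 0) (catrev (nseq s.-1 (s.-1, 0) ++ (s.-1, s) :: L)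
                (drop s ((0, f) :: R))) k =
   if i <= k < i + s then (s.-1, if k == i then s else 0)
   else nth (0, 0) (catrev L ((0, f) :: R)) k.
  rewrite !catrevE rev_cat rev_cons cat_rcons -!catA !nth_cat /= !size_rev szL.
  case: (ltnP k i) => //= ik; rewrite size_nseq ?rev_nseq.
  have -> : (k - i < s.-1.+1) = (k < i + s) by lia.
  case: ifP => ks.
    have [->|ki] := eqVneq k i; first by rewrite subnn.
    have -> : k - i = (k - i).-1.+1 by lia.
    by rewrite /= nth_nseq ifT //; lia.
  have -> : k - i = s + (k - i - s) by lia.
  by rewrite -nth_drop; congr nth; lia.
split=> //.
- by rewrite size_cat size_nseq /= szL; lia.
- by rewrite size_drop /=; lia.
- move=> k kn; rewrite nthk; have [c1 c2] := colP k kn.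
  case: ifP => ik; last first.
    have -> : (k < i + s) = (k < i) by lia.
    split=> // t m tT' lm cv; rewrite bE // -(c1 t m) //.
    case: eqP => // tE; subst t; move: cv; rewrite /covers /=; lia.
  have -> : k < i + s by lia.
  have kiF : (k < i) = false by lia.
  rewrite kiF addn0 in c1.
  have nk : (nth (0, 0) (catrev L ((0, f) :: R)) k).1 = 0.
    have := c1 _ j tT; rewrite /covers /before /=; lia.
  rewrite nk addn0 in c1.
  split=> /= [t m tT' lm cv|]; last first.
    case: eqP => [->|_]; last exact: tiling_size0.
    have -> : j + 1 + s.-1 = j + s by lia.
    exact (tiling_above tilT tT).
  rewrite bE //; have -> : j + 1 + s.-1 = j + s by lia.
  case: ltnP => ms.
    by apply/orP; left; apply/eqP; apply: (tiling_disjoint tilT tT' tT cv);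
       rewrite /covers /=; lia.
  rewrite (c1 t m) //; last by lia.
  apply/negbTE; rewrite negb_or; apply/andP; split; last by lia.
  by apply: contraTneq cv => ->; rewrite /covers /=; lia.
- exact (tiling_right tilT tT).
- move=> t; rewrite inE PP; case: (boolP (t \in T)) => tT'; first by rewrite bE.
  by rewrite orbF; apply: contraNF tT' => /eqP->.
Qed.

(** The branch that places the squares of [T] keeps the invariant and ends at a leaf, where [good]
    must hold. Exhausted fuel gives [false], so termination needs no separate argument. *)
Lemma searchP good fuel i j lf P L R :
  search_inv i j lf P L R -> search n good fuel i j lf P L R ->
  exists2 Q, Q =i T & good Q.
Proof.
elim: fuel i j lf P L R => // k IH i j lf P L [|[[|r] f] R] inv0;
  rewrite /search -/search.
- case: eqP => [jn gP|jn]; last first.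
    by apply: IH; apply: (inv_newline _ inv0); have := inv_row inv0; lia.
  exists P => // t; rewrite (inv_placed inv0).
  case: (boolP (t \in T)) => // /(tiling_range tilT)[].
  by have := inv_right inv0; rewrite /before /=; lia.
- move=> /allP sP; have := inv_right inv0; have := inv_row inv0 => /= jn szR.
  have [|t tT cv] := tiling_cover tilT (i := i) _ jn; first by lia.
  (* The square over this free cell is not placed yet, so its corner does not precede [(i, j)] and
     must be [(i, j)]. *)
  have tE : t = (i, j, t.2).
    have [|c1 _] := inv_column inv0 (k := i); first by lia.
    rewrite catrevE nth_cat size_rev (inv_left inv0) ltnn subnn addn0 /= in c1.
    have := c1 t j tT (leqnn j) cv; move: cv.
    by case: t {tT c1} => [[x y] s]; rewrite /covers /before /= => *;
      congr (_, _, _); lia.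
  rewrite tE in tT; have [nf nlf /sP] := inv_place_size inv0 tT.
  by rewrite (negbTE nf) (negbTE nlf); apply: IH; apply: inv_place inv0 tT.
- by apply: IH; apply: inv_shift inv0.
Qed.

Lemma search_allP good : 0 < n -> search_all n good ->
  exists2 Q, Q =i T & good Q.
Proof.
move=> n0; apply: searchP; split=> //.
- by rewrite size_nseq.
- move=> k kn; rewrite /= nth_nseq kn; split=> /=; last exact: tiling_size0.
  by move=> t m _ _ _; rewrite /before /=; lia.
- exact: tiling_proper.
- by move=> t; rewrite in_nil /before ltn0 andbF /= andbF.
Qed.

End Search.

(** * Half-open tilings and integrality *)

Section Geometry.
Variable R : realType.
Local Open Scope classical_set_scope.
Local Open Scope ring_scope.
Implicit Types (e : element R) (p : R * R) (s : seq (element R)).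

Lemma rectangleP (a b c d : R) p :
  rectangle a b c d p <-> (a <= p.1 <= b) && (c <= p.2 <= d).
Proof. by rewrite /rectangle /= !in_itv /=; split => [[-> ->]|/andP]. Qed.

Lemma squareP e p : square e p <->
  (e.1.1 <= p.1 <= e.1.1 + e.2%:R) && (e.1.2 <= p.2 <= e.1.2 + e.2%:R).
Proof. exact: rectangleP. Qed.

Lemma interior_squareP e p : (square e)° p <->
  (e.1.1 < p.1 < e.1.1 + e.2%:R) && (e.1.2 < p.2 < e.1.2 + e.2%:R).
Proof.
case: p => x y /=; split => [|/andP[xP yP]].
  (* A product neighbourhood inside the square projects to neighbourhoods inside both intervals. *)
  move=> [[/= A B] [/= nA nB] AB].
  have /= Ax := nbhs_singleton nA; have /= By := nbhs_singleton nB.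
  have: (`[e.1.1, e.1.1 + e.2%:R]%classic : set R)° x.
    by apply: filterS nA => u Au; have /= [] := AB (u, y) (conj Au By).
  have: (`[e.1.2, e.1.2 + e.2%:R]%classic : set R)° y.
    by apply: filterS nB => u Bu; have /= [] := AB (x, u) (conj Ax Bu).
  by rewrite !interior_itv_bnd /= !in_itv /= => -> ->.
exists (`]e.1.1, (e.1.1 + e.2%:R)[%classic, `]e.1.2, (e.1.2 + e.2%:R)[%classic).
  by split=> /=; apply: near_in_itvoo; rewrite in_itv.
by move=> [u v] [] /= /subset_itv_oo_cc ? /subset_itv_oo_cc ?.
Qed.

(** Each rectangle contains its own two extreme corners; their membership in the other one gives all
    the inequalities. *)
Lemma rectangle_inj (a b c d a' b' c' d' : R) :
  a <= b -> c <= d -> a' <= b' -> c' <= d' ->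
  rectangle a b c d = rectangle a' b' c' d' ->
  [/\ a = a', b = b', c = c' & d = d'].
Proof.
move=> ab cd ab' cd' E.
have mem x y :
    (a <= x <= b) && (c <= y <= d) = (a' <= x <= b') && (c' <= y <= d').
  by apply/idP/idP => /(rectangleP _ _ _ _ (x, y));
    [rewrite E|rewrite -E] => /rectangleP.
have := mem a c; have := mem b d; have := mem a' c'; have := mem b' d'.
rewrite !lexx ab cd ab' cd' /=.
move=> /andP[/andP[h1 h2] /andP[h3 h4]] /andP[/andP[h5 h6] /andP[h7 h8]].
move=> /esym /andP[/andP[h9 h10] /andP[h11 h12]].
move=> /esym /andP[/andP[h13 h14] /andP[h15 h16]].
by split; apply/eqP; rewrite eq_le; apply/andP.
Qed.

Definition half_open e p :=
  (e.1.1 <= p.1 < e.1.1 + e.2%:R) && (e.1.2 <= p.2 < e.1.2 + e.2%:R).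

Record half_open_tiling n s : Prop := {
  half_open_range e : e \in s ->
    [/\ (0 < e.2)%N, 0 <= e.1.1, 0 <= e.1.2,
        e.1.1 + e.2%:R <= n%:R & e.1.2 + e.2%:R <= n%:R];
  half_open_cover p : 0 <= p.1 < n%:R -> 0 <= p.2 < n%:R ->
    exists2 e, e \in s & half_open e p;
  half_open_disjoint e e' p : e \in s -> e' \in s ->
    half_open e p -> half_open e' p -> e = e'
}.

(** Serves to move a point slightly without reaching the next of finitely many coordinates. *)
Lemma gap_right (s : seq R) (u c : R) : u < c ->
  exists2 w, u < w < c & forall x, x \in s -> u < x -> w < x.
Proof.
move=> uc; elim: s => [|x s [w /andP[uw wc] wP]].
  by exists ((u + c) / 2) => //; lra.
have [xu|ux] := leP x u.
  exists w; rewrite ?uw// => y; rewrite inE => /predU1P[->|/wP//].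
  by rewrite ltNge xu.
exists (Num.min w ((u + x) / 2)).
  by rewrite lt_min uw gt_min wc /=; lra.
move=> y; rewrite inE gt_min => /predU1P[->|ys uy]; last by rewrite wP.
by move=> _; apply/orP; right; lra.
Qed.

Lemma gap_left (s : seq R) (u c : R) : u < c ->
  exists2 w, u < w < c & forall x, x \in s -> x < c -> x < w.
Proof.
move=> uc; have [|w /andP[cw wu] wP] := @gap_right (map -%R s) (- c) (- u).
  by rewrite ltrN2.
exists (- w); first by rewrite ltrNr wu ltrNl cw.
by move=> x xs xc; rewrite ltrNr wP ?ltrN2// map_f.
Qed.

(** Points are moved slightly right and up, past no left or lower edge: the closed element over the
    moved point contains the original one in the half-open sense. A point of two half-open elements
    would move into both interiors. *)
Lemma dissection_half_open n s :
  dissection n [set` s] -> half_open_tiling n s.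
Proof.
move=> [_ _ pos dis cov].
have sub e p : e \in s -> square e p ->
    (0 <= p.1 <= n%:R) && (0 <= p.2 <= n%:R).
  move=> es ep; have : rectangle 0 n%:R 0 n%:R p by rewrite -cov; exists e.
  by move/rectangleP.
have sizegt0 e : e \in s -> 0 < e.2%:R :> R by move=> /pos; rewrite ltr0n.
split.
- move=> e es; have s0 := sizegt0 _ es.
  have /andP[/andP[/= -> _] /andP[-> _]] :
      (0 <= e.1.1 <= n%:R) && (0 <= e.1.2 <= n%:R).
    by apply: (sub e e.1) => //; apply/squareP; rewrite !lexx !lerDl ltW.
  have /andP[/andP[/= _ ->] /andP[_ ->]] :
      (0 <= e.1.1 + e.2%:R <= n%:R) && (0 <= e.1.2 + e.2%:R <= n%:R).
    apply: (sub e (e.1.1 + e.2%:R, e.1.2 + e.2%:R)) => //.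
    by apply/squareP; rewrite /= !lexx !lerDl ltW.
  by split=> //; exact: pos.
- case=> u v /= /andP[u0 un] /andP[v0 vn].
  have [u' /andP[uu' u'n] u'P] := gap_right [seq e.1.1 | e <- s] un.
  have [v' /andP[vv' v'n] v'P] := gap_right [seq e.1.2 | e <- s] vn.
  have : rectangle 0 n%:R 0 n%:R (u', v') by apply/rectangleP => /=; lra.
  rewrite -cov => -[e es /squareP /= /andP[/andP[eu' u'e] /andP[ev' v'e]]].
  exists e => //; apply/andP; split; apply/andP; split => /=; try lra.
    by rewrite leNgt; apply/negP => /(u'P _ (map_f _ es)); lra.
  by rewrite leNgt; apply/negP => /(v'P _ (map_f _ es)); lra.
- move=> e e' [u v] es e's /andP[/= /andP[h1 h2] /andP[h3 h4]].
  move=> /andP[/= /andP[h5 h6] /andP[h7 h8]].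
  have [|u' /andP[u1 u2] _] := @gap_right [::] u
      (Num.min (e.1.1 + e.2%:R) (e'.1.1 + e'.2%:R)).
    by rewrite lt_min h2.
  have [|v' /andP[v1 v2] _] := @gap_right [::] v
      (Num.min (e.1.2 + e.2%:R) (e'.1.2 + e'.2%:R)).
    by rewrite lt_min h4.
  rewrite !lt_min in u2 v2; move/andP: u2 => [u2 u3]; move/andP: v2 => [v2 v3].
  apply: dis => //; exists (u', v'); split; apply/interior_squareP => /=; lra.
Qed.

Definition transpose {A B : Type} (t : A * A * B) := (t.1.2, t.1.1, t.2).

Lemma half_open_transpose e p :
  half_open (transpose e) p = half_open e (p.2, p.1).
Proof. by rewrite /half_open andbC. Qed.

Lemma half_open_tiling_transpose n s :
  half_open_tiling n s -> half_open_tiling n (map transpose s).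
Proof.
move=> [range cov dis]; split.
- by move=> _ /mapP[e /range[? ? ? ? ?] ->].
- move=> p p1 p2; have [e es ep] := cov (p.2, p.1) p2 p1.
  by exists (transpose e); rewrite ?map_f// half_open_transpose.
- move=> _ _ p /mapP[e es ->] /mapP[e' e's ->].
  rewrite !half_open_transpose => h h'.
  by rewrite (dis _ _ _ es e's h h').
Qed.

(* The left neighbour of an element starts at a smaller abscissa that differs
   from that of the element by an integer. *)
Lemma corner_nat n s e : half_open_tiling n s -> e \in s ->
  exists k : nat, e.1.1 = k%:R.
Proof.
move=> [range cov dis] es.
(* Induction on a natural bound for the abscissa, which drops by one at the left neighbour since
   sizes are at least 1. *)
have : e.1.1 < n.+1%:R.
  have [_ _ _ + _] := range _ es; have : 0 <= e.2%:R :> R by [].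
  by rewrite -natr1; lra.
elim: n.+1 e es => [|N IH] e es eN.
  by have [_] := range _ es; rewrite leNgt eN.
have [e20 e0 f0 en fn] := range _ es.
have s0 : 0 < e.2%:R :> R by rewrite ltr0n.
have [->|ne0] := eqVneq e.1.1 0; first by exists 0%N.
(* [w] exceeds every right edge of smaller abscissa than [e], so the element [d] over [(w, e.1.2)]
   reaches [e]; it cannot pass the corner of [e]. *)
have [|w /andP[w0 we] wP] := @gap_left [seq d.1.1 + d.2%:R | d <- s] 0 e.1.1.
  by rewrite lt_neqAle eq_sym ne0.
have [| |d ds /andP[/= /andP[d1 d2] d3]] := cov (w, e.1.2); rewrite /=; try lra.
have dE : d.1.1 + d.2%:R = e.1.1.
  case: (ltgtP (d.1.1 + d.2%:R) e.1.1) => [lt|lt|//].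
    by have /= := wP _ (map_f _ ds) lt; lra.
  have de : d = e.
    apply: (dis _ _ e.1 ds es); rewrite /half_open;
      last by rewrite !lexx !ltrDl s0.
    by rewrite d3 lt andbT; lra.
  by move: d1; rewrite de; lra.
have d20 : 1 <= d.2%:R :> R by rewrite ler1n; have [] := range _ ds.
have [|k dk] := IH d ds; first by move: eN; rewrite -natr1; lra.
by exists (k + d.2)%N; rewrite natrD -dk dE.
Qed.
End Geometry.

(** * Integer dissections *)

(** In [(a, b, c, d)], [a, b] are the abscissas and [c, d] the ordinates of the
    end points. *)
Definition nat_sides (t : nat * nat * nat) : seq (nat * nat * nat * nat) :=
  let: (x, y, s) := t in
  [:: (x, x, y, y + s); (x + s, x + s, y, y + s);
      (x, x + s, y, y); (x, x + s, y + s, y + s)].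

Definition separated (t t' : nat * nat * nat) :=
  [|| t.1.1 + t.2 <= t'.1.1, t'.1.1 + t'.2 <= t.1.1,
      t.1.2 + t.2 <= t'.1.2 | t'.1.2 + t'.2 <= t.1.2].

Definition squared_squareb n (T : seq (nat * nat * nat)) :=
  [&& 0 < n, if T is [:: t, t' & _] then t != t' else false,
      all (fun t => [&& 0 < t.2, t.1.1 + t.2 <= n & t.1.2 + t.2 <= n]) T,
      all (fun i => all (fun j => has (fun t => covers t i j) T) (iota 0 n))
        (iota 0 n) &
      allrel (fun t t' => (t == t') ||
          separated t t' &&
          ((t.2 == t'.2) ==> ~~ has (mem (nat_sides t')) (nat_sides t))) T T].

Section Corners.
Variable R : realType.
Local Open Scope classical_set_scope.
Local Open Scope ring_scope.

Definition nat_element (t : nat * nat * nat) : element R :=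
  (t.1.1%:R, t.1.2%:R, t.2).

Definition nat_rectangle (q : nat * nat * nat * nat) : set (R * R) :=
  rectangle q.1.1.1%:R q.1.1.2%:R q.1.2%:R q.2%:R.

Lemma of_seqP T (e : element R) :
  @of_seq R T e <-> exists2 t, t \in T & e = nat_element t.
Proof. by split=> [[t /= tT <-]|[t tT ->]]; exists t. Qed.

Lemma nat_element_inj : injective nat_element.
Proof.
move=> [[x y] s] [[x' y'] s'] [] /eqP; rewrite eqr_nat => /eqP -> /eqP.
by rewrite eqr_nat => /eqP -> ->.
Qed.

Lemma covers_half_open t i j :
  covers t i j = half_open (nat_element t) (i%:R, j%:R).
Proof. by rewrite /half_open /= -!natrD !ler_nat !ltr_nat. Qed.

Lemma sides_nat_element t (S : set (R * R)) :
  sides (nat_element t) S <->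
  exists2 q, q \in nat_sides t & S = nat_rectangle q.
Proof.
case: t => [[x y] s]; rewrite /sides /nat_sides /=; split.
- have nr a b c d :
      rectangle a%:R b%:R c%:R d%:R = nat_rectangle (a, b, c, d) by [].
  rewrite -!natrD !nr => -[[[->|->]|->]|->]; [exists (x, x, y, y + s)%N|
    exists (x + s, x + s, y, y + s)%N|exists (x, x + s, y, y)%N|
    exists (x, x + s, y + s, y + s)%N]; by rewrite // !inE eqxx ?orbT.
- by move=> [q]; rewrite !inE => /or4P[] /eqP -> ->;
    rewrite /nat_rectangle /= !natrD;
    [left; left; left|left; left; right|left; right|right].
Qed.

Lemma unit_cell n (u : R) : (0 < n)%N -> 0 <= u <= n%:R ->
  exists2 i, (i < n)%N & i%:R <= u <= i.+1%:R.
Proof.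
case: n => // n _; elim: n => [|n IH] /andP[u0 un];
  first by exists 0%N; rewrite ?u0.
have [nu|nu] := leP n.+1%:R u; first by exists n.+1; rewrite ?nu.
have [|i ni iu] := IH; first by rewrite u0 ltW.
by exists i => //; apply: leqW.
Qed.

Lemma nat_rectangle_inj t t' q q' : q \in nat_sides t -> q' \in nat_sides t' ->
  nat_rectangle q = nat_rectangle q' -> q = q'.
Proof.
have le r s : r \in nat_sides s -> (r.1.1.1 <= r.1.1.2)%N /\ (r.1.2 <= r.2)%N.
  by case: s => [[x y] s]; rewrite !inE => /or4P[] /eqP -> /=; lia.
move=> /le[h1 h2] /le[h3 h4] /rectangle_inj[]; rewrite ?ler_nat //.
move=> /eqP + /eqP + /eqP + /eqP; rewrite !eqr_nat.
move: q q' {h1 h2 h3 h4} => [[[a b] c] d] [[[a' b'] c'] d'] /=.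
by move=> /eqP-> /eqP-> /eqP-> /eqP->.
Qed.

Lemma squared_squarebP n T :
  squared_squareb n T -> squared_square n (@of_seq R T).
Proof.
move=> /and5P[n0 two /allP range /allP cov /allrelP pairs].
split=> //.
- split.
  + by apply: finite_image; exact: finite_seq.
  + case: T two {range cov pairs} => [//|t [//|t' T]] /eqP tt'.
    exists (nat_element t), (nat_element t').
    by split; [apply/of_seqP; exists t; rewrite ?inE ?eqxx
              |apply/of_seqP; exists t'; rewrite ?inE ?eqxx ?orbT
              |move/nat_element_inj].
  + by move=> _ /of_seqP[t /range /and3P[t0 _ _] ->].
  + move=> _ _ /of_seqP[t tT ->] /of_seqP[t' t'T ->].
    move=> [[u v] [/interior_squareP + /interior_squareP]].
    have := pairs _ _ tT t'T; case: eqP => [->//|_] /= /andP[+ _].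
    rewrite /= -!natrD => sep /andP[/andP[h1 h2] /andP[h3 h4]].
    move=> /andP[/andP[h5 h6] /andP[h7 h8]].
    by exfalso; case/or4P: sep; rewrite -(ler_nat R) /=; lra.
  + apply/seteqP; split=> [[u v] [_ /of_seqP[t tT ->] /squareP]
                            |[u v] /rectangleP] /=.
      have /and3P[_] := range _ tT; rewrite -!(ler_nat R) /= !natrD => h1 h2 h3.
      apply/rectangleP => /=; have := ler0n R t.1.1; have := ler0n R t.1.2; lra.
    (* A real point lies in some closed unit cell, and the closed square covering that cell contains
       it. *)
    move=> /andP[/(unit_cell n0)[i ni ip] /(unit_cell n0)[j nj jp]].
    have := cov i; rewrite mem_iota => /(_ ni) /allP /(_ j); rewrite mem_iota.
    move=> /(_ nj) /hasP[t tT /andP[/andP[h1 h2] /andP[h3 h4]]].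
    exists (nat_element t); first by apply/of_seqP; exists t.
    apply/squareP; rewrite /= -!natrD.
    move: h1 h2 h3 h4; rewrite -!(ler_nat R); lra.
- move=> _ _ /of_seqP[t tT ->] /of_seqP[t' t'T ->] tt' /= st.
  apply/seteqP; split=> // S.
  move=> [/sides_nat_element[q qt ->] /sides_nat_element[q' qt' E]].
  have := pairs _ _ tT t'T; case: eqP => [tE|_] /=; first by rewrite tE in tt'.
  rewrite st eqxx /= => /andP[_ /hasP]; apply; exists q => //.
  by rewrite (nat_rectangle_inj qt qt' E).
Qed.

(** Corners are integral, so truncation recovers them; ordinates are handled through the transposed
    tiling. *)
Lemma squared_square_nat n (D : set (element R)) : squared_square n D ->
  exists2 T, tiling n T & D = @of_seq R T.
Proof.
move=> [n0 disD ntD].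
have [s DE] : exists s : seq (element R), D = [set` s].
  by apply/finite_seqP; case: disD.
rewrite {}DE in disD ntD *.
have hs := dissection_half_open disD.
have nat1 e : e \in s -> e.1.1 = (Num.truncn e.1.1)%:R.
  by move=> /(corner_nat hs)[k ->]; rewrite natrK.
have nat2 e : e \in s -> e.1.2 = (Num.truncn e.1.2)%:R.
  move=> es; have := corner_nat (half_open_tiling_transpose hs) (map_f _ es).
  by move=> /= [k ->]; rewrite natrK.
pose f (e : element R) := (Num.truncn e.1.1, Num.truncn e.1.2, e.2).
have fK e : e \in s -> nat_element (f e) = e.
  by case: e => [[x y] z] es; rewrite /nat_element /= -(nat1 _ es) -(nat2 _ es).
have mapE t : (t \in map f s) = (nat_element t \in s).
  apply/mapP/idP => [[e es ->]|ts]; first by rewrite fK.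
  by exists (nat_element t) => //; apply: nat_element_inj; rewrite fK.
have no_common t t' S : nat_element t \in s -> nat_element t' \in s ->
    t <> t' -> t.2 = t'.2 ->
    ~ (sides (nat_element t) S /\ sides (nat_element t') S).
  move=> ts t's tt' st [h1 h2].
  have := ntD _ _ ts t's (fun E => tt' (nat_element_inj E)) st.
  by move=> /seteqP[/(_ S) + _]; apply.
exists (map f s); last first.
  apply/seteqP; split=> e /=.
    by move=> es; apply/of_seqP; exists (f e); rewrite ?map_f ?fK.
  by move=> /of_seqP[t]; rewrite mapE => ? ->.
split.
- move=> t; rewrite mapE => /(half_open_range hs)[/= t0 _ _].
  by rewrite -!natrD !ler_nat.
- move=> i j ni nj; have [| |e es ep] := half_open_cover hs (p := (i%:R, j%:R)).
  + by rewrite /= ler0n ltr_nat.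
  + by rewrite /= ler0n ltr_nat.
  by exists (f e); rewrite ?map_f// covers_half_open fK.
- move=> t t' i j; rewrite !mapE !covers_half_open => ts t's h h'.
  by apply: nat_element_inj; exact (half_open_disjoint hs ts t's h h').
(* A square filling everything contains the corner of every element, so all elements would coincide
   with it. *)
- rewrite mapE; apply/negP => ns.
  have [e1 [e2 [e1s e2s]]] := dissection_two disD; apply.
  have all0 e : e \in s -> e = nat_element (0%N, 0%N, n).
    move=> es; have [e0 ex ey exn eyn] := half_open_range hs es.
    have e0R : 0 < e.2%:R :> R by rewrite ltr0n.
    by apply: (half_open_disjoint hs (p := e.1)) => //;
      rewrite /half_open /=; lra.
  by rewrite (all0 _ e1s) (all0 _ e2s).
- move=> x y z; rewrite !mapE => ts; apply/negP => t's.
  have z0 : (0 < z)%N by have [] := half_open_range hs ts.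
  (* The common side is the right side of one square and the left side of the other. *)
  apply: (no_common _ _ (nat_rectangle (x + z, x + z, y, y + z))%N
            ts t's) => //.
    by move=> [] ?; lia.
  by split; apply/sides_nat_element;
    exists (x + z, x + z, y, y + z)%N; rewrite // !inE eqxx ?orbT.
- move=> x y z; rewrite !mapE => ts; apply/negP => t's.
  have z0 : (0 < z)%N by have [] := half_open_range hs ts.
  apply: (no_common _ _ (nat_rectangle (x, x + z, y + z, y + z))%N
            ts t's) => //.
    by move=> [] ?; lia.
  by split; apply/sides_nat_element;
    exists (x, x + z, y + z, y + z)%N; rewrite // !inE eqxx ?orbT.
Qed.

Lemma eq_of_seq T T' : T =i T' -> @of_seq R T = @of_seq R T'.
Proof.
by move=> E; apply/seteqP; split=> e /of_seqP[t tT ->]; apply/of_seqP; exists t;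
  rewrite // ?E // -E.
Qed.

Lemma mirrored_transpose n T :
  mirrored n (@of_seq R T) (@of_seq R (map transpose T)).
Proof.
exists (fun p => (p.2, p.1)); first by left; right.
have swap t : square (nat_element (transpose t)) =
    (fun p => (p.2, p.1)) @` square (nat_element t).
  apply/seteqP; split=> [[u v] /squareP h|_ [p /squareP h <-]].
    by exists (v, u) => //; apply/squareP; rewrite /= andbC.
  by apply/squareP; rewrite /= andbC.
apply/seteqP; split=> [_ [_ /of_seqP[_ /mapP[t tT ->] ->] <-]
                      |_ [_ /of_seqP[t tT ->] <-]].
- by exists (nat_element t); [apply/of_seqP; exists t|rewrite swap].
- exists (nat_element (transpose t)); last by rewrite swap.
  by apply/of_seqP; exists (transpose t); rewrite ?map_f.
Qed.
End Corners.

(** * The two dissections and the final enumeration *)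

Definition d11 : seq (nat * nat * nat) := [::
  (0, 0, 4); (7, 0, 4); (0, 7, 4); (7, 7, 4);
  (4, 0, 3); (0, 4, 3); (8, 4, 3); (4, 8, 3);
  (4, 3, 2); (6, 4, 2); (3, 5, 2); (5, 6, 2);
  (3, 4, 1); (6, 3, 1); (5, 5, 1); (7, 6, 1); (4, 7, 1)].

Definition d16 : seq (nat * nat * nat) := [::
  (0, 0, 4); (12, 0, 4); (0, 12, 4); (12, 12, 4);
  (7, 0, 5); (0, 4, 5); (11, 7, 5); (4, 11, 5);
  (5, 5, 6);
  (4, 0, 3); (13, 4, 3); (0, 9, 3); (9, 13, 3);
  (5, 3, 2); (11, 5, 2); (3, 9, 2); (9, 11, 2);
  (4, 3, 1); (12, 4, 1); (3, 11, 1); (11, 12, 1)].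

(** [perm_eq] absorbs the order of placement. For [n] other than 11 and 16 this is false, so a
    successful search means that no tiling exists. *)
Definition listed n (T : seq (nat * nat * nat)) :=
  (n == 11) && (perm_eq T d11 || perm_eq T (map transpose d11)) ||
  (n == 16) && (perm_eq T d16 || perm_eq T (map transpose d16)).

Lemma search_listed : all (fun n => search_all n (listed n)) (iota 1 17).
Proof. by vm_compute. Qed.

Theorem mainTheorem1 (R : realType) :
  [/\ squared_square 11 (D11 R),
      squared_square 16 (D16 R) &
      forall (n : nat) (D : set (element R)),
        (n <= 17)%N -> squared_square n D ->
        (n = 11 /\ (D = D11 R \/ mirrored 11 (D11 R) D)) \/
        (n = 16 /\ (D = D16 R \/ mirrored 16 (D16 R) D))].
Proof.
(* [D11 R] and [D16 R] unfold to these lists, on which the boolean test is evaluated. *)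
split; [exact: (@squared_squarebP R 11 d11)
       |exact: (@squared_squarebP R 16 d16)|].
move=> n D n17 sqD; have [n0 _ _] := sqD.
have [T tilT ->] := squared_square_nat sqD.
have ok : search_all n (listed n).
  by move/allP: search_listed; apply; rewrite mem_iota n0.
have [Q QT] := search_allP tilT n0 ok.
rewrite -(eq_of_seq R QT).
move=> /orP[] /andP[/eqP->] /orP[] /perm_mem/(eq_of_seq R) ->.
- by left; split; [|left].
- by left; split; [|right; exact: (mirrored_transpose R 11 d11)].
- by right; split; [|left].
- by right; split; [|right; exact: (mirrored_transpose R 16 d16)].
Qed.
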